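(* Let $k$ be a positive integer and let $m\neq k$ be a positive factor of $k$. Let $\alpha=\frac{a+k\sqrt3}{c}$ (with $a,c\in\mathbb{Z}$, $c\neq0$) be an ambiguous number with $(a,k,c)\neq1$, and suppose that $\alpha=\frac{a'+m\sqrt3}{c'}$ with $a',c'\in\mathbb{Z}$, $(a',m,c')=1$ and $c'\mid a'^2-3m^2$. Then $\alpha$ does not lie in the closed path of ambiguous numbers of the form $\frac{x+k\sqrt3}{y}$ ($x,y\in\mathbb{Z}$). In other words, ambiguous numbers of the form $\frac{a'+m\sqrt3}{c'}$ with these properties do not exist in the closed path of ambiguous numbers of the form $\frac{x+k\sqrt3}{y}$.
   Context: Here $(x,y,z)$ denotes the greatest common divisor of the integers $x,y,z$, and $x\mid y$ means $x$ divides $y$. The Picard group $\Gamma=PSL(2,\mathbb{Z}[i])$ acts on $\mathbb{Q}(i,\sqrt3)\cup\{\infty\}$ by linear fractional transformations and is generated by $A(z)=\frac{1}{z-i}$, $B(z)=\frac1z$, $C(z)=\frac{1+z}{-z}$, $D(z)=\frac{-1}{z}$. An ambiguous number is a real quadratic irrational number $\alpha=\frac{a+b\sqrt3}{c}\in\mathbb{Q}(i,\sqrt3)$ with $a,b,c\in\mathbb{Z}$, $c\neq0$, such that $\alpha$ and its conjugate $\bar\alpha=\frac{a-b\sqrt3}{c}$ have opposite signs. A closed path of ambiguous numbers is a pair of circuits of ambiguous numbers joined by $B$-edges. Precisely, it is a set $P$ of the form $P=\{\beta_0,\dots,\beta_{2n-1}\}\cup\{B(\beta_0),\dots,B(\beta_{2n-1})\}$,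 with $n\ge1$, where $\beta_0,\dots,\beta_{2n-1}$ are pairwise distinct ambiguous numbers such that (indices modulo $2n$) $\beta_{2j+1}\in\{C(\beta_{2j}),C^2(\beta_{2j})\}$ and $\beta_{2j+2}=D(\beta_{2j+1})$ for all $j$. The closed path of ambiguous numbers of the form $\frac{x+k\sqrt3}{y}$ is the closed path having $k\sqrt3$ as an element. *)

(* Defs.v *)
From mathcomp Require Import all_boot all_order all_algebra all_field.

Set Implicit Arguments.
Unset Strict Implicit.
Unset Printing Implicit Defensive.

Import Order.TTheory GRing.Theory Num.Theory.
Local Open Scope ring_scope.

(* The field Q(i, sqrt 3) is viewed inside [algC], the field of complex        *)
(* algebraic numbers; there, [x < y] holds only if [y - x] is real.             *)
Definition sqrt3 : algC := sqrtC 3.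

Definition qnum (a b c : int) : algC :=
  (a%:~R + b%:~R * sqrt3) / c%:~R.

(* The conjugate of [qnum a b c] is [qnum a (- b) c]; it depends only on the    *)
(* number, not on the chosen triple, since 1 and sqrt 3 are independent over Q. *)
Definition ambiguous (z : algC) : Prop :=
  exists a b c : int,
    [/\ b != 0, c != 0, z = qnum a b c
      & (0 < z /\ qnum a (- b) c < 0) \/ (z < 0 /\ 0 < qnum a (- b) c)].

(* The point at infinity is [None]. *)
Definition mobius (p q r s : algC) (z : option algC) : option algC :=
  if z is Some u then
    if r * u + s == 0 then None else Some ((p * u + q) / (r * u + s))
  else if r == 0 then None else Some (p / r).

Definition genB := mobius 0 1 1 0.
Definition genC := mobius 1 1 (- 1) 0.
Definition genD := mobius 0 (- 1) 1 0.

(* [ordS i] is [i + 1] modulo [2 * n]. *)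
Definition closed_path (P : {pred option algC}) : Prop :=
  exists (n : nat) (beta : 'I_(2 * n) -> algC),
    [/\ (0 < n)%N,
        injective beta,
        forall i : 'I_(2 * n), ambiguous (beta i),
        forall i : 'I_(2 * n), if odd i
          then Some (beta (ordS i)) = genD (Some (beta i))
          else Some (beta (ordS i)) = genC (Some (beta i)) \/
               Some (beta (ordS i)) = genC (genC (Some (beta i)))
      & P =i [seq Some (beta i) | i : 'I_(2 * n)]
             ++ [seq genB (Some (beta i)) | i : 'I_(2 * n)]].

(* The path is pinned down by containing k sqrt 3: each ambiguous number has    *)
(* exactly one ambiguous image under C and C^2, B commutes with D, and          *)
(* B C B = C^2, so two closed paths that meet are equal.                        *)
Definition closed_path_of (k : int) (P : {pred option algC}) : Prop :=
  closed_path P /\ Some (k%:~R * sqrt3) \in P.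

(* Main.v *)
Require Import Defs.
From mathcomp Require Import all_boot all_order all_algebra all_field.
From mathcomp Require Import ring.

(** A number [(a' + m sqrt 3) / c'] with [c' | a'^2 - 3 m^2] is a root of the
    integral binary quadratic form [c' X^2 - 2 a' X + b], where
    [b c' = a'^2 - 3 m^2], and this form has discriminant [12 m^2].  Integral
    Moebius maps of determinant [1] or [-1] act on such forms by a change of
    variables that preserves the discriminant ([form_root_mobius]), and every
    edge of a closed path is such a map.  Following the cycle from [alpha], every
    number of the path is then a root of a form of discriminant [12 m^2]
    ([form_root_closed_path]).  On the other hand, as [sqrt 3] is irrational, the
    forms that vanish at [k sqrt 3] are the multiples [c (X^2 - 3 k^2)], of
    discriminant [12 (k c)^2]; so [k] divides [m] ([form_root_ksqrt3]), which is
    impossible for a proper divisor [m] of [k]. *)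

Set Implicit Arguments.
Unset Strict Implicit.
Unset Printing Implicit Defensive.

Import Order.TTheory GRing.Theory Num.Theory.
Local Open Scope ring_scope.

(** A quarter of the discriminant of [c X^2 - 2 a X + b] is [a^2 - b c].  Being a
    root, unlike being a fraction [(a + m sqrt 3) / c], is polynomial in the data,
    so that a change of variables needs no case analysis on [b] and [c]. *)
Definition form_root (m : int) (z : algC) : Prop :=
  exists a b c : int,
    a ^+ 2 - b * c = 3 * m ^+ 2 /\
    c%:~R * z ^+ 2 - 2 * a%:~R * z + b%:~R = 0.

Lemma sqr_sqrt3 : sqrt3 ^+ 2 = 3.
Proof. exact: sqrtCK. Qed.

(** The [3]-adic valuation of the left side is even, that of the right side odd
    unless [y = 0]. *)
Lemma sqr_eq_3sqr (x y : int) : x ^+ 2 = 3 * y ^+ 2 -> y = 0.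
Proof.
move=> xy; apply/eqP; rewrite -absz_eq0; apply/negPn/negP; rewrite -lt0n => y0.
have {}xy : (`|x| ^ 2 = 3 * `|y| ^ 2)%N by rewrite -!abszX xy abszM.
have := congr1 (odd \o logn 3) xy.
by rewrite /= lognM ?expn_gt0 ?y0 // !lognX [logn 3 3]logn_prime // oddD !oddM.
Qed.

Lemma form_root_qnum (m a c : int) :
  c != 0 -> (c %| a ^+ 2 - 3 * m ^+ 2)%Z -> form_root m (qnum a m c).
Proof.
move=> c0 /dvdzP[b Eb]; exists a, b, c; split; first by rewrite -Eb; ring.
have cC0 : c%:~R != 0 :> algC by rewrite intr_eq0.
have EbC : b%:~R = (a%:~R ^+ 2 - sqrt3 ^+ 2 * m%:~R ^+ 2) / c%:~R :> algC.
  rewrite sqr_sqrt3; apply: (canRL (mulfK cC0)).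
  by rewrite -intrM -Eb; ring.
by rewrite /qnum EbC; field.
Qed.

(** The new form is the old one in the variable [(s w - q) / (p - r w)], the
    inverse map, with the denominator cleared. *)
Lemma form_root_mobius (m p q r s : int) (z w : algC) :
  (p * s - q * r) ^+ 2 = 1 -> form_root m z ->
  mobius p%:~R q%:~R r%:~R s%:~R (Some z) = Some w -> form_root m w.
Proof.
move=> det [a [b [c [disc Fz]]]] /=; case: eqVneq => // d0 [<-].
exists (c * s * q + a * (s * p + q * r) + b * p * r),
  (c * q ^+ 2 + 2 * a * q * p + b * p ^+ 2),
  (c * s ^+ 2 + 2 * a * s * r + b * r ^+ 2); split.
  transitivity ((p * s - q * r) ^+ 2 * (a ^+ 2 - b * c)); first by ring.
  by rewrite det mul1r.
(* At the image of [z] the new form is [(det / (r z + s))^2] times the old. *)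
transitivity (((p * s - q * r)%:~R / (r%:~R * z + s%:~R)) ^+ 2
              * (c%:~R * z ^+ 2 - 2 * a%:~R * z + b%:~R)); last first.
  by rewrite Fz mulr0.
by field.
Qed.

Lemma form_root_genB (m : int) (z w : algC) :
  form_root m z -> genB (Some z) = Some w -> form_root m w.
Proof. exact: (@form_root_mobius m 0 1 1 0). Qed.

Lemma form_root_genC (m : int) (z w : algC) :
  form_root m z -> genC (Some z) = Some w -> form_root m w.
Proof. exact: (@form_root_mobius m 1 1 (- 1) 0). Qed.

Lemma form_root_genD (m : int) (z w : algC) :
  form_root m z -> genD (Some z) = Some w -> form_root m w.
Proof. exact: (@form_root_mobius m 0 (- 1) 1 0). Qed.

Lemma ambiguous_neq0 (z : algC) : ambiguous z -> z != 0.
Proof.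
by case=> a [b [c [_ _ _ [[z0 _]|[z0 _]]]]]; [rewrite gt_eqF | rewrite lt_eqF].
Qed.

Lemma genB_neq0 (z : algC) : z != 0 -> genB (Some z) = Some z^-1.
Proof.
by move=> z0; rewrite /genB /= mul1r mul0r add0r addr0 (negPf z0) div1r.
Qed.

Lemma form_root_inv (m : int) (z : algC) :
  z != 0 -> form_root m z^-1 <-> form_root m z.
Proof.
move=> z0; split=> Fz; apply: (form_root_genB Fz); last exact: genB_neq0.
by rewrite genB_neq0 ?invr_eq0 // invrK.
Qed.

Lemma ordS_ind (n : nat) (Q : 'I_n -> Prop) (i : 'I_n) :
  (forall j, Q j -> Q (ordS j)) -> Q i -> forall j, Q j.
Proof.
move=> QS Qi j.
have val_iter t : val (iter t (@ordS n) i) = ((i + t) %% n)%N.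
  elim: t => [|t IHt] /=; first by rewrite addn0 modn_small.
  by rewrite IHt -addn1 modnDml addn1 addnS.
(* Stepping [n - i] times reaches [0], then [j] more steps reach [j]. *)
have -> : j = iter (n - i + j) (@ordS n) i.
  apply: val_inj; rewrite val_iter addnA subnKC 1?ltnW //.
  by rewrite modnDl modn_small.
by elim: (n - i + j)%N => [|t IHt] //=; apply: QS.
Qed.

(** One root propagates forward along the cycle of the [beta i], hence, the cycle
    being closed, to all of it; the [B]-edges go back and forth as [B] is an
    involution. *)
Lemma form_root_closed_path (m : int) (P : {pred option algC}) (z w : algC) :
  closed_path P -> Some z \in P -> Some w \in P ->
  form_root m z -> form_root m w.
Proof.
case=> n [beta [_ _ amb edge PE]]; rewrite !PE.
have beta0 i : beta i != 0 by apply: ambiguous_neq0.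
have mem_path x :
    Some x \in [seq Some (beta i) | i : 'I_(2 * n)]
               ++ [seq genB (Some (beta i)) | i : 'I_(2 * n)] ->
    exists i, form_root m x <-> form_root m (beta i).
  rewrite mem_cat => /orP[] /imageP[i _].
    by move=> [->]; exists i.
  by rewrite genB_neq0 // => -[->]; exists i; apply: form_root_inv.
move=> /mem_path[i Fi] /mem_path[j Fj] /Fi Fbi; apply/Fj.
apply: (@ordS_ind _ (fun l => form_root m (beta l)) i) => // l Fl.
move: (edge l); case: (odd l) => [E|[E|]]; first exact: form_root_genD Fl _.
  exact: form_root_genC Fl _.
case E: (genC (Some (beta l))) => [v|] E2.
  exact: form_root_genC (form_root_genC Fl E) _.
(* [C] sends only [0] to infinity. *)
by move: E; rewrite /genC /= addr0 mulN1r oppr_eq0 (negPf (beta0 l)).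
Qed.

Lemma form_root_ksqrt3 (k m : int) :
  k != 0 -> form_root m (k%:~R * sqrt3) -> (k %| m)%Z.
Proof.
move=> k0 [a [b [c [disc Fk]]]].
(* The equation splits into its parts along [1] and [sqrt 3]. *)
have parts0 : 3 * c * k ^+ 2 + b = 0 /\ a = 0.
  have EC : (3 * c * k ^+ 2 + b)%:~R = 2 * a%:~R * k%:~R * sqrt3 :> algC.
    apply/eqP; rewrite -subr_eq0 -{}Fk; apply/eqP.
    by rewrite exprMn sqr_sqrt3; ring.
  have E : (3 * c * k ^+ 2 + b) ^+ 2 = 3 * (2 * a * k) ^+ 2.
    by apply: (@intr_inj algC); rewrite rmorphXn /= EC exprMn sqr_sqrt3; ring.
  have a0 : a = 0.
    have /eqP := sqr_eq_3sqr E.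
    by rewrite !mulf_eq0 (negPf k0) orbF => /eqP.
  by split=> //; apply/eqP; rewrite -sqrf_eq0 E a0; apply/eqP; ring.
case: parts0 => Eb a0.
have E : 3 * m ^+ 2 = 3 * (k * c) ^+ 2.
  by rewrite -disc a0 (canRL (addKr _) Eb); ring.
have /eqP := mulfI (isT : (3 : int) != 0) E.
rewrite eqf_sqr => /orP[] /eqP->; last by rewrite -mulrN; apply: dvdz_mulr.
exact: dvdz_mulr.
Qed.

Theorem proposition5 (k m : int) (k_gt0 : 0 < k) (m_gt0 : 0 < m)
    (m_neq_k : m != k) (m_dvd_k : (m %| k)%Z)
    (alpha : algC) (alpha_amb : ambiguous alpha)
    (a c : int) (c_neq0 : c != 0) (alphaE : alpha = qnum a k c)
    (gcd_akc : gcdz (gcdz a k) c != 1)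
    (a' c' : int) (c'_neq0 : c' != 0) (alphaE' : alpha = qnum a' m c')
    (gcd_a'mc' : gcdz (gcdz a' m) c' = 1)
    (c'_dvd : (c' %| a' ^+ 2 - 3 * m ^+ 2)%Z)
    (P : {pred option algC}) (P_path : closed_path_of k P) :
  Some alpha \notin P.
Proof.
case: P_path => path_P kP; apply/negP => aP.
have Fk : form_root m (k%:~R * sqrt3).
  apply: form_root_closed_path path_P aP kP _.
  by rewrite alphaE'; apply: form_root_qnum.
have k_dvd_m := form_root_ksqrt3 (lt0r_neq0 k_gt0) Fk.
move/eqP: m_neq_k; apply.
rewrite -(gtz0_abs m_gt0) -(gtz0_abs k_gt0); congr Posz.
by apply/eqP; rewrite eqn_dvd; apply/andP.
Qed.
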